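(* Let $X,Y,Z$ be real normed linear spaces, with $X$ infinite dimensional. Let $A\subset X$ be a nonempty open convex set, let $B\subset Y$ be a convex set, and let $G\colon B\to Z$ be a mapping which is unbounded on some bounded subset of $B$. Then there exists a d.c. mapping $F\colon A\to B$ (that is, d.c. as a mapping into $Y$ with values in $B$) such that $G\circ F$ is not d.c. on $A$.
   Context: Let $X,Y$ be real normed linear spaces and $C\subset X$ convex. A continuous mapping $F\colon C\to Y$ is called d.c. (delta-convex) if there is a continuous function $f\colon C\to\mathbb{R}$ (a control function of $F$) such that $y^*\circ F+f$ is convex on $C$ for every $y^*\in Y^*$ with $\|y^*\|\le 1$. In particular a mapping that is not continuous is not d.c. The mapping $G$ is not assumed continuous. *)

(* Defs.v *)
From HB Require Import structures.
From mathcomp Require Import all_boot all_order all_algebra.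
From mathcomp Require Import all_classical all_reals all_analysis.

Set Implicit Arguments.
Unset Strict Implicit.
Unset Printing Implicit Defensive.

Import Order.TTheory GRing.Theory Num.Theory.
Import numFieldNormedType.Exports.

Local Open Scope classical_set_scope.
Local Open Scope ring_scope.

Definition finite_dimensional (R : realType) (X : normedModType R) : Prop :=
  exists (n : nat) (e : 'I_n -> X),
    forall x : X, exists c : 'I_n -> R, x = \sum_(i < n) c i *: e i.

(* Only meaningful for continuous [phi]: [sup] of an unbounded set is [0]. *)
Definition dual_norm (R : realType) (Y : normedModType R)
    (phi : {linear Y -> R^o}) : R :=
  sup [set `|phi y| | y in [set y : Y | `|y| <= 1]].

(* Mappings on [C] are represented by total functions on [X] whose values
   outside [C] play no role. *)
Definition control_function (R : realType) (X Y : normedModType R)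
    (C : set X) (F : X -> Y) (f : X -> R^o) : Prop :=
  {within C, continuous f} /\
  forall phi : {linear Y -> R^o}, continuous phi -> dual_norm phi <= 1 ->
    convex_function C (fun x => phi (F x) + f x).

Definition delta_convex (R : realType) (X Y : normedModType R)
    (C : set X) (F : X -> Y) : Prop :=
  {within C, continuous F} /\ exists f : X -> R^o, control_function C F f.

(* Main.v *)
(** Call [f] a control function of [G o F]. If [f] is bounded near a point [a]
    of [A] then it is bounded on every ball around [p = th q + (1 - th) a], [q] in
    [A], whose radius is less than [1 - th] times the radius of boundedness at
    [a], and on such a ball [G o F] is bounded as well. So it suffices to build a
    delta-convex [F] which, on balls around points [p_k] with radii
    [s_k <= (1 - th_k) / (k + 1)], runs through infinitely many points [y_i] with
    [|G y_i| > i].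

    Let [u_i], [xi_i] be a bounded biorthogonal sequence (Mazur's construction)
    and [mu] a continuous convex function on [A] that blows up along a segment
    or ray on which the [p_k] are chosen. The convex functions
    [h_i x = max 0 (xi_i (x - p_k) / s_k + be_k (mu x - mu p_k + 1))], where [k]
    is the block of [i] and [be_k] grows fast, are locally equicontinuous, and at
    [w_i = p_k + s_k u_i] the function [h_i] exceeds all the others by [1]. The
    slope [be_k] makes the blocks with large [k] invisible near a given point, so
    no weak* null sequence of functionals is needed. With [M = sup_j h_j] and
    [S_i = max (sup_(j != i) h_j) (h_i - 1)], at most one bump [M - S_i] is
    nonzero at each point, and [F = y_0 + sum_i (M - S_i) (y_i - y_0)] takes values
    in [B] and sends [w_i] to [y_i]. It is delta-convex because
    [2 M - sum_i c_i (M - S_i) = sup_i ((2 - c_i) h_i + c_i S_i)] is convex for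
    all [c_i] in [0, 1]. *)

Require Import Defs.
From HB Require Import structures.
From mathcomp Require Import all_boot all_order all_algebra.
From mathcomp Require Import all_classical all_reals all_analysis.
From mathcomp Require Import ring lra.

Set Implicit Arguments.
Unset Strict Implicit.
Unset Printing Implicit Defensive.

Import Order.TTheory GRing.Theory Num.Theory.
Import numFieldNormedType.Exports.

Local Open Scope classical_set_scope.
Local Open Scope ring_scope.

(** * Convexity, continuity and dual norms as inequalities *)

Lemma convex_functionP (R : realType) (E : lmodType R) (D : set E)
    (f : E -> R^o) :
  convex_function D f <->
  forall x y (t : R), D x -> D y -> 0 <= t -> t <= 1 ->
    f (t *: x + (1 - t) *: y) <= t * f x + (1 - t) * f y.
Proof.
split=> [cf x y t Dx Dy t0 t1|cf t x y].
  have := cf (Itv01 t0 t1) x y; rewrite !inE => /(_ Dx Dy).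
  by [].
by rewrite !inE => Dx Dy; exact: cf.
Qed.

Lemma convex_setP (R : realType) (E : lmodType R) (D : set E) :
  convex_set D ->
  forall x y (t : R), D x -> D y -> 0 <= t -> t <= 1 ->
    D (t *: x + (1 - t) *: y).
Proof.
move=> cD x y t Dx Dy t0 t1.
by have := cD x y (Itv01 t0 t1); rewrite !inE; exact.
Qed.

Lemma open_within_continuousP (R : realType) (X V : normedModType R)
    (A : set X) (f : X -> V) : open A ->
  {within A, continuous f} <->
  forall x, A x -> forall e, 0 < e -> exists r, 0 < r /\
    forall y, `|x - y| < r -> A y /\ `|f x - f y| <= e.
Proof.
move=> oA; rewrite continuous_open_subspace//; split=> [cf x Ax e e0|cf x].
  have nA : nbhs x A by exact: open_nbhs_nbhs.
  have cx : {for x, continuous f} by apply: cf; rewrite inE.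
  have : \forall y \near x, A y /\ `|f x - f y| <= e.
    near=> y; split; first by near: y.
    by near: y; move/cvgrPdist_le : cx; exact.
  by move=> /nbhs_normP[r /= r0 rA]; exists r; split => // y /rA.
rewrite inE => Ax; apply/cvgrPdist_le => e e0.
have [r [r0 rP]] := cf x Ax e e0.
by apply/nbhs_normP; exists r => //= y /rP[].
Unshelve. all: by end_near. Qed.

Lemma open_ballP (R : realType) (X : normedModType R) (A : set X) (x : X) :
  open A -> A x -> exists r, 0 < r /\ forall y, `|x - y| < r -> A y.
Proof.
move=> oA Ax; have /nbhs_normP[r /= r0 rA] : nbhs x A.
  exact: open_nbhs_nbhs.
by exists r.
Qed.

(** Continuity bounds the set in [dual_norm], so its [sup] is a true supremum; it is tested at the
    normalised vector. *)
Lemma dual_normP (R : realType) (Y : normedModType R)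
    (phi : {linear Y -> R^o}) (y : Y) :
  continuous phi -> dual_norm phi <= 1 -> `|phi y| <= `|y|.
Proof.
move=> cphi n1; have [->|y0] := eqVneq y 0; first by rewrite linear0 !normr0.
have ny : 0 < `|y| by rewrite normr_gt0.
have [M HM] : exists M, forall x, `|x| <= 1 -> `|phi x| <= M.
  exact: ((bounded_funP phi).2 ((linear_bounded_continuous phi).2 cphi) 1).
have : `|phi (`|y|^-1 *: y)| <= 1.
  apply: le_trans n1; apply: ub_le_sup; last first.
    by exists (`|y|^-1 *: y) => //=; rewrite normrZ gtr0_norm ?invr_gt0// mulVf// gt_eqF.
  by exists M => _ [x /= x1 <-]; exact: HM.
rewrite linearZ normrZ gtr0_norm ?invr_gt0//.
by rewrite mulrC ler_pdivrMr// mul1r.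
Qed.

Lemma dual_norm_le1 (R : realType) (Y : normedModType R)
    (phi : {linear Y -> R^o}) :
  (forall y, `|phi y| <= `|y|) -> continuous phi /\ dual_norm phi <= 1.
Proof.
move=> H; split.
  apply/linear_bounded_continuous/bounded_funP => r.
  by exists r => x; exact: le_trans.
apply: ge_sup; first by exists `|phi 0|; exists 0 => //=; rewrite normr0.
by move=> _ [x /= x1 <-]; exact: le_trans x1.
Qed.

(** * The Hahn-Banach theorem *)

Definition sublinear (R : realType) (X : lmodType R) (q : X -> R) :=
  (forall x y, q (x + y) <= q x + q y) /\
  (forall t x, 0 <= t -> q (t *: x) = t * q x).

(** The reverse inequality is the assumed one applied to [t^-1] and [t *: x]. *)
Lemma sublinear_homogW (R : realType) (X : lmodType R) (q : X -> R) :
  q 0 = 0 -> (forall t x, 0 < t -> q (t *: x) <= t * q x) ->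
  forall t x, 0 <= t -> q (t *: x) = t * q x.
Proof.
move=> q0 qZ t x; rewrite le_eqVlt => /predU1P[<-|t0].
  by rewrite scale0r mul0r.
apply/eqP; rewrite eq_le qZ//=.
have := qZ t^-1 (t *: x); rewrite invr_gt0 => /(_ t0).
by rewrite scalerA mulVf ?gt_eqF// scale1r mulrC ler_pdivlMr// mulrC.
Qed.

Lemma sublinear0 (R : realType) (X : lmodType R) (q : X -> R) :
  sublinear q -> q 0 = 0.
Proof. by move=> [_ /(_ 0 0 (lexx _))]; rewrite scale0r mul0r. Qed.

Lemma sublinearN (R : realType) (X : lmodType R) (q : X -> R) x :
  sublinear q -> - q (- x) <= q x.
Proof.
move=> sq; rewrite lerNl -subr_ge0 opprK addrC.
by have [+ _] := sq; move=> /(_ x (- x)); rewrite subrr sublinear0.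
Qed.

(* The functional [x |-> inf_(t >= 0) p (x + t y) - t p y]. *)
Lemma sublinear_slide (R : realType) (X : lmodType R) (p : X -> R) (y : X) :
  sublinear p -> exists q : X -> R, [/\ sublinear q, forall x, q x <= p x &
    forall x, q x <= p (x + y) - p y].
Proof.
move=> sp; have [pD pZ] := sp.
pose E x := [set p (x + t *: y) - t * p y | t in [set t : R | 0 <= t]].
pose q x := inf (E x).
(* Indeed [t * p y = p (t *: y) <= p (x + t *: y) + p (- x)]. *)
have lE x : has_lbound (E x).
  exists (- p (- x)) => _ [t /= t0 <-].
  rewrite lerBrDr -pZ// addrC lerBlDr.
  by rewrite (le_trans _ (pD _ _))// addrAC subrr add0r.
have nE x : E x !=set0 by exists (p (x + 0 *: y) - 0 * p y); exists 0 => /=.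
have qle x t : 0 <= t -> q x <= p (x + t *: y) - t * p y.
  by move=> t0; apply: ge_inf => //; exists t.
have q1 x : q x <= p x by have := qle x 0 (lexx _); rewrite scale0r mul0r addr0 subr0.
exists q; split => //; last first.
  by move=> x; have := qle x 1 ler01; rewrite scale1r mul1r.
split=> [x z|].
  rewrite -lerBlDr; apply: lb_le_inf => // _ [t /= t0 <-].
  rewrite lerBlDr -lerBlDl; apply: lb_le_inf => // _ [s /= s0 <-].
  rewrite lerBlDl; apply: le_trans (qle _ (t + s) (addr_ge0 t0 s0)) _.
  have := pD (x + t *: y) (z + s *: y).
  by rewrite scalerDl mulrDl addrACA; lra.
apply: sublinear_homogW => [|t x t0].
  have q00 : q 0 <= 0 by rewrite -(sublinear0 sp).
  apply/eqP; rewrite eq_le q00/=.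
  apply: lb_le_inf => // _ [s /= s0 <-].
  by rewrite add0r pZ// subrr.
rewrite -ler_pdivrMl//; apply: lb_le_inf => // _ [s /= s0 <-].
rewrite ler_pdivrMl//.
apply: le_trans (qle _ (t * s) (mulr_ge0 (ltW t0) s0)) _.
by rewrite mulrBr -(pZ t _ (ltW t0)) scalerDr scalerA mulrA.
Qed.

(** Zorn's lemma for the reversed pointwise order. The infimum of a nonempty chain is subadditive
    because the smaller of two members serves both arguments. *)
Lemma minimal_sublinear (R : realType) (X : lmodType R) (p : X -> R) :
  sublinear p -> exists q : X -> R, [/\ sublinear q, forall x, q x <= p x &
    forall q', sublinear q' -> (forall x, q' x <= q x) -> q' = q].
Proof.
move=> sp.
pose T := {q : X -> R | sublinear q /\ forall x, q x <= p x}.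
pose r (q1 q2 : T) := `[< forall x, sval q2 x <= sval q1 x >].
have [| | | |[q [sq qp]] qmin] := @Zorn T r.
- by move=> q; apply/asboolP.
- move=> a b c /asboolP ab /asboolP bc; apply/asboolP => x.
  exact: le_trans (bc x) (ab x).
- move=> [a Pa] [b Pb] /asboolP /= ab /asboolP /= ba.
  have E : a = b by apply/funext => x; apply/eqP; rewrite eq_le ab ba.
  by move: Pa Pb; rewrite E => Pa Pb; congr exist; exact: Prop_irrelevance.
- move=> A totA; have [A0|/set0P[q0 Aq0]] := eqVneq A set0.
    by exists (exist _ p (conj sp (fun x => lexx _))) => s; rewrite A0.
  pose E x := [set sval q x | q in A].
  have nE x : E x !=set0 by exists (sval q0 x); exists q0.
  have lE x : has_lbound (E x).
    exists (- p (- x)) => _ [q Aq <-]; have [sq qp] := svalP q.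
    by rewrite (le_trans _ (sublinearN _ sq))// lerN2.
  have qle x q : A q -> inf (E x) <= sval q x.
    by move=> Aq; apply: ge_inf => //; exists q.
  have sE : sublinear (fun x => inf (E x)).
    split=> [x y|].
      rewrite -lerBlDr; apply: lb_le_inf => // _ [q1 Aq1 <-].
      rewrite lerBlDr -lerBlDl; apply: lb_le_inf => // _ [q2 Aq2 <-].
      rewrite lerBlDl.
      have [/asboolP q12|/asboolP q21] := totA q1 q2 Aq1 Aq2.
        apply: le_trans (qle _ q2 Aq2) _.
        rewrite (le_trans ((svalP q2).1.1 _ _))// lerD2r.
        exact: q12.
      apply: le_trans (qle _ q1 Aq1) _.
      rewrite (le_trans ((svalP q1).1.1 _ _))// lerD2l.
      exact: q21.
    apply: sublinear_homogW => [|t x t0].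
      have E0 (q : T) : sval q 0 = 0 by exact: sublinear0 (svalP q).1.
      have E00 : inf (E 0) <= 0 by rewrite -(E0 q0) qle.
      apply/eqP; rewrite eq_le E00/=.
      by apply: lb_le_inf => // _ [q Aq <-]; rewrite E0.
    rewrite -ler_pdivrMl//; apply: lb_le_inf => // _ [q Aq <-].
    by rewrite ler_pdivrMl// (le_trans (qle _ _ Aq))// (svalP q).1.2// ltW.
  have Ep x : inf (E x) <= p x.
    by rewrite (le_trans (qle _ _ Aq0))//; exact: (svalP q0).2.
  pose t0 : T := exist _ (fun x => inf (E x)) (conj sE Ep).
  exists t0 => q Aq; apply/asboolP => x /=.
  exact: qle.
- exists q; split => // q' sq' q'q.
  have q'p x : q' x <= p x by exact: le_trans (q'q x) (qp x).
  pose t0 : T := exist _ q' (conj sq' q'p).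
  by have /(_ _)/(congr1 sval)/= -> := qmin t0; last exact/asboolP.
Qed.

(* A minimal sublinear functional coincides with its slides, which forces it to
   be additive; sliding [p] along [u] first gives the value at [u]. *)
Lemma hahn_banach (R : realType) (X : lmodType R) (p : X -> R) (u : X) :
  sublinear p -> exists f : {linear X -> R^o},
    (forall x, f x <= p x) /\ p u <= f u.
Proof.
move=> sp; have [p' [sp' p'p p'u]] := sublinear_slide u sp.
have [q [sq qp' qmin]] := minimal_sublinear sp'.
have qD x y : q (x + y) = q x + q y.
  apply/eqP; rewrite eq_le sq.1/=.
  have [q' [sq' q'q q'y]] := sublinear_slide y sq.
  by rewrite -lerBrDr -[q x](congr1 (@^~ x) (qmin _ sq' q'q)).
have qN x : q (- x) = - q x.
  by apply/eqP; rewrite -addr_eq0 -qD addrC subrr sublinear0.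
have qL : linear (q : X -> R^o).
  move=> t x y; rewrite qD; congr (_ + _).
  have [t0|t0] := leP 0 t; first by rewrite sq.2.
  rewrite -[t]opprK scaleNr qN sq.2 ?oppr_ge0 1?ltW//.
  by rewrite [RHS]scaleNr.
pose L := GRing.isLinear.Build R X R^o *:%R (q : X -> R^o) qL.
pose f : {linear X -> R^o} := HB.pack (q : X -> R^o) L.
exists f; split=> [x|]; first exact: le_trans (qp' x) (p'p x).
(* Sliding bounds [q (- u)] by [p 0 - p u]; negation gives the value at [u]. *)
have := le_trans (qp' (- u)) (p'u (- u)).
by rewrite addNr (sublinear0 sp) sub0r qN lerN2.
Qed.

(** Hahn-Banach for the distance to [V], which vanishes on [V], is at most the norm and is at least
    [d] at [u]. Dividing by [f u] costs the factor [d^-1]. *)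
Lemma annihilating_functional (R : realType) (X : normedModType R) (V : set X)
    (u : X) (d : R) :
  V 0 -> (forall t v w, V v -> V w -> V (t *: v + w)) -> 0 < d ->
  (forall v, V v -> d <= `|u - v|) ->
  exists f : {linear X -> R^o}, [/\ forall v, V v -> f v = 0, f u = 1 &
    forall x, `|f x| <= d^-1 * `|x|].
Proof.
move=> V0 VL d0 dV.
have VD v w : V v -> V w -> V (v + w).
  by move=> Vv Vw; rewrite -[v]scale1r; exact: VL.
have VZ t v : V v -> V (t *: v) by move=> Vv; rewrite -[_ *: _]addr0; exact: VL.
pose E x := [set `|x - v| | v in V].
pose p x := inf (E x).
have lE x : has_lbound (E x) by exists 0 => _ [v _ <-].
have nE x : E x !=set0 by exists `|x - 0|; exists 0.
have ple x v : V v -> p x <= `|x - v| by move=> Vv; apply: ge_inf => //; exists v.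
have p0 x : 0 <= p x by apply: lb_le_inf => // _ [v _ <-].
have sp : sublinear p.
  split=> [x y|].
    rewrite -lerBlDr; apply: lb_le_inf => // _ [v Vv <-].
    rewrite lerBlDr -lerBlDl; apply: lb_le_inf => // _ [w Vw <-].
    rewrite lerBlDl; apply: le_trans (ple _ (v + w) (VD _ _ Vv Vw)) _.
    by rewrite opprD addrACA ler_normD.
  apply: sublinear_homogW => [|t x t0].
    by apply/eqP; rewrite eq_le p0 andbT (le_trans (ple _ 0 V0))// subrr normr0.
  rewrite -ler_pdivrMl//; apply: lb_le_inf => // _ [v Vv <-].
  rewrite ler_pdivrMl// (le_trans (ple _ _ (VZ t v Vv)))// -scalerBr normrZ.
  by rewrite gtr0_norm.
have [f [fp fu]] := hahn_banach u sp.
have fn x : `|f x| <= `|x|.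
  have px y : p y <= `|y| by rewrite (le_trans (ple _ 0 V0))// subr0.
  rewrite ler_norml (le_trans (fp _) (px _)) andbT lerNl -linearN.
  by rewrite (le_trans (fp _))// -[leRHS]normrN.
have fu0 : d <= f u.
  by apply: le_trans fu; apply: lb_le_inf => // _ [v Vv <-]; exact: dV.
have fu1 : 0 < f u by exact: lt_le_trans fu0.
exists ((f u)^-1 \*: f); split => [v Vv||x] /=.
- have pv w : V w -> f w <= 0.
    by move=> Vw; rewrite (le_trans (fp _))// (le_trans (ple _ _ Vw))// subrr normr0.
  suff -> : f v = 0 by rewrite scaler0.
  apply/eqP; rewrite eq_le pv//= -oppr_le0 -linearN pv//.
  by rewrite -scaleN1r; exact: VZ.
- by rewrite /GRing.scale/= mulVf// gt_eqF.
- rewrite normrZ gtr0_norm ?invr_gt0//.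
  by apply: ler_pM => //; rewrite ?invr_ge0 ?(ltW fu1)// lef_pV2.
Qed.

Lemma norming_functional (R : realType) (X : normedModType R) (u : X) :
  exists f : {linear X -> R^o}, f u = `|u| /\ forall x, `|f x| <= `|x|.
Proof.
have [->|u0] := eqVneq u 0.
  by exists \0; split=> [|x] /=; rewrite normr0.
have nu : 0 < `|u| by rewrite normr_gt0.
have [||||f [_ fu fn]] := @annihilating_functional R X [set 0] u `|u| => //.
- by move=> t v w /= -> ->; rewrite scaler0 addr0.
- by move=> v /= ->; rewrite subr0.
exists (`|u| \*: f); split=> [|x] /=.
  by rewrite fu /GRing.scale/= mulr1.
rewrite normrZ normr_id (le_trans (ler_pM _ _ (lexx _) (fn x)))//.
by rewrite mulrA mulfV ?mul1r// gt_eqF.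
Qed.

(** * Bounded biorthogonal sequences *)

(** Dependent choice with the whole past as input: [P n e p] sees only the entries of [e] before
    [n]. *)
Lemma dependent_sequence (T : Type) (t0 : T)
    (P : nat -> (nat -> T) -> T -> Prop) :
  (forall n e e' p, (forall k, (k < n)%N -> e k = e' k) ->
    P n e p -> P n e' p) ->
  (forall n e, (forall k, (k < n)%N -> P k e (e k)) -> exists p, P n e p) ->
  exists e, forall n, P n e (e n).
Proof.
move=> Pext Pex.
have /choice[nxt nxtP] : forall ne : nat * (nat -> T), exists p : T,
    (exists p', P ne.1 ne.2 p') -> P ne.1 ne.2 p.
  move=> [n e]; have [[p Pp]|nP] := pselect (exists p', P n e p').
    by exists p.
  by exists t0.
(* [E n] is correct below [n]; entry [m] is written at stage [m.+1] and never changed, so the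
   diagonal agrees with all later stages. *)
pose E := fix E n : nat -> T := if n is m.+1 then
  (fun k => if k == m then nxt (m, E m) else E m k) else (fun=> t0).
pose e n := E n.+1 n.
have Ee n k : (k < n)%N -> E n k = e k.
  elim: n => // n IHn; rewrite ltnS leq_eqVlt => /predU1P[->//|kn] /=.
  by rewrite (ltn_eqF kn) IHn.
exists e => n; elim/ltn_ind: n => n IHn.
have [|p Pp] := Pex n (E n).
  move=> k kn; rewrite Ee//; apply: Pext (IHn k kn) => j jk.
  by rewrite Ee// (ltn_trans jk).
apply: Pext (Ee n) _; rewrite /e /= eqxx.
by apply: (nxtP (n, E n)); exists p.
Qed.

(** A further functional either vanishes on the common kernel so far or costs one more spanning
    vector [z]. *)
Lemma common_kernel_finite_codim (R : realType) (X : lmodType R) (n : nat)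
    (f : nat -> {linear X -> R^o}) :
  exists m (e : 'I_m -> X), forall x, exists c : 'I_m -> R,
    forall i, (i < n)%N -> f i (x - \sum_(j < m) c j *: e j) = 0.
Proof.
elim: n => [|n [m [e eP]]].
  by exists 0%N, (fun=> 0) => x; exists (fun=> 0).
have [[z [zn fz]]|nz] :=
    pselect (exists z, (forall i, (i < n)%N -> f i z = 0) /\ f n z != 0).
  exists m.+1, (fun i => if unlift ord0 i is Some j then e j else z) => x.
  have [c cP] := eP x; pose y := x - \sum_(j < m) c j *: e j.
  exists (fun i => if unlift ord0 i is Some j then c j else f n y / f n z).
  move=> i; rewrite big_ord_recl unlift_none.
  under eq_bigr do rewrite liftK.
  rewrite [X in x - X]addrC opprD addrA -/y linearB linearZ/=.
  rewrite ltnS leq_eqVlt => /predU1P[->|i_n].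
    by rewrite /GRing.scale/= divfK// subrr.
  by rewrite (zn i i_n) scaler0 subr0 cP.
exists m, e => x; have [c cP] := eP x; exists c => i.
rewrite ltnS leq_eqVlt => /predU1P[->|]; last exact: cP.
apply/eqP/negP => /negP fn; apply: nz.
by exists (x - \sum_(j < m) c j *: e j).
Qed.

(** A trivial common kernel would make the finitely many complementary vectors span [X]. *)
Lemma unit_vector_common_kernel (R : realType) (X : normedModType R) (n : nat)
    (f : nat -> {linear X -> R^o}) : ~ finite_dimensional X ->
  exists u : X, `|u| = 1 /\ forall i, (i < n)%N -> f i u = 0.
Proof.
move=> infX; have [m [e eP]] := common_kernel_finite_codim n f.
apply: contrapT => nu; apply: infX; exists m, e => x.
have [c cP] := eP x; exists c; apply/eqP; rewrite -subr_eq0.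
apply/negP => /negP y0; apply: nu.
exists (`|x - \sum_(j < m) c j *: e j|^-1 *: (x - \sum_(j < m) c j *: e j)).
split=> [|i i_n]; last by rewrite linearZ/= cP// scaler0.
by rewrite normrZ normfV normr_id mulVf// normr_eq0.
Qed.

(* The coordinate functionals bound the coefficients, so the unit sphere of the
   span is a closed subset of the image of a cube, hence compact. *)
Lemma finitely_many_norming_functionals (R : realType) (X : normedModType R)
    (n : nat) (u : nat -> X) (xi : nat -> {linear X -> R^o}) (C : R) :
  (forall i j, (i < n)%N -> (j < n)%N -> xi i (u j) = (i == j)%:R) ->
  (forall i x, (i < n)%N -> `|xi i x| <= C * `|x|) ->
  exists N (zeta : nat -> {linear X -> R^o}),
    (forall i x, `|zeta i x| <= `|x|) /\
    forall c : 'I_n -> R, exists i, (i < N)%N /\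
      `|\sum_(j < n) c j *: u j| / 2 <= zeta i (\sum_(j < n) c j *: u j).
Proof.
move=> xiu xiC.
have /choice[f fP] : forall v : X, exists f : {linear X -> R^o},
  f v = `|v| /\ forall x, `|f x| <= `|x| by exact: norming_functional.
pose L (c : 'rV[R]_n) : X := \sum_(j < n) c 0 j *: u j.
have cL : continuous L.
  rewrite (_ : L = \sum_(j < n) (fun c => c 0 j *: u j)); last first.
    by apply/funext => c; rewrite fct_sumE.
  elim/big_ind: _ => [|g h cg ch c|j _ c]; first exact: cst_continuous.
    exact: (continuousD (cg c) (ch c)).
  by apply: cvgZr_tmp; [exact: (@nbhs_filter _ c)|exact: coord_continuous].
pose K := [set c : 'rV[R]_n | forall i, c ord0 i \in `[- C, C]].
have cK : compact K.
  by apply: (@rV_compact _ _ (fun=> `[- C, C]%classic)) => _; exact: segment_compact.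
pose S := [set L c | c in K] `&` [set v : X | `|v| = 1].
have cS : compact S.
  apply: compact_closedI.
    by apply: continuous_compact cK; exact: continuous_subspaceT.
  rewrite (_ : [set v : X | `|v| = 1] = Num.norm @^-1` [set 1]) //.
  by apply: closed_comp => [x _|]; [exact: norm_continuous|exact: closed_eq].
have cf v : continuous (f v) by have [] := dual_norm_le1 (fP v).2.
move: cS; rewrite compact_cover => /(_ X S (fun v => [set x | 2^-1 < f v x])).
case=> [v _|v Sv|D DS Dcov].
- rewrite (_ : [set x | _] = f v @^-1` [set t | 2^-1 < t])//.
  by apply: open_comp => [x _|]; [exact: cf|exact: open_gt].
- exists v => //=; rewrite (fP v).1; case: Sv => _ /= ->; lra.
pose s := finmap.enum_fset D.
(* The successor keeps index [0%N] available for the zero vector even if the subcover is empty. *)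
exists (size s).+1, (fun i => f (nth 0 s i)); split=> [i x|c].
  exact: (fP _).2.
set v := \sum_(j < n) _.
have [->|v0] := eqVneq v 0; first by exists 0%N; rewrite linear0 normr0 mul0r.
have nv : 0 < `|v| by rewrite normr_gt0.
have Sv : S (`|v|^-1 *: v).
  have nw : `| (`|v|^-1 *: v) | = 1 by rewrite normrZ normfV normr_id mulVf// gt_eqF.
  split=> //; exists (\row_j (c j / `|v|)).
    move=> i; rewrite mxE /= in_itv/= -ler_norml.
    have -> : c i / `|v| = xi i (`|v|^-1 *: v).
      rewrite linearZ/= linear_sum (bigD1 i)//= linearZ/= xiu// eqxx.
      rewrite big1 => [|j ji]; last first.
        have ij : (i == j :> nat) = false by rewrite eq_sym; exact: negbTE.
        by rewrite linearZ/= xiu// ij scaler0.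
      by rewrite addr0 /GRing.scale/= mulr1 mulrC.
    by rewrite (le_trans (xiC _ _ _))// nw mulr1.
  rewrite /L /v scaler_sumr; apply: eq_bigr => j _.
  by rewrite mxE scalerA mulrC.
have [w /= Dw fw] := Dcov _ Sv.
exists (index w s); split; first by rewrite ltnS index_size.
have ws : w \in s by [].
rewrite nth_index//; move: fw; rewrite linearZ/= /GRing.scale/=.
by rewrite ltr_pdivlMl// => /ltW.
Qed.

(** The next vector is killed by the earlier [xi] and by finitely many functionals norming the
    earlier span up to a factor [2]. It then stays away from that span, and a functional
    annihilating the span is the next [xi]. *)
Lemma bounded_biorthogonal_sequence (R : realType) (X : normedModType R) :
  ~ finite_dimensional X ->
  exists (u : nat -> X) (xi : nat -> {linear X -> R^o}),
    [/\ forall n, `|u n| = 1, forall n x, `|xi n x| <= 4 * `|x| &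
      forall m n, xi m (u n) = (m == n)%:R].
Proof.
move=> infX.
pose T := (X * {linear X -> R^o})%type.
pose P n (e : nat -> T) (p : T) := [/\ `|p.1| = 1,
  forall x, `|p.2 x| <= 4 * `|x|, p.2 p.1 = 1 &
  forall i, (i < n)%N -> (e i).2 p.1 = 0 /\ p.2 (e i).1 = 0].
pose z : {linear X -> R^o} := \0.
have [||e eP] := @dependent_sequence T (0, z) P.
- move=> n e e' p ee' [p1 p2 p3 p4]; split=> // i i_n.
  by rewrite -ee'//; exact: p4.
- move=> n e eP.
  have xiu i j : (i < n)%N -> (j < n)%N -> (e i).2 (e j).1 = (i == j)%:R.
    move=> i_n jn; have [ij|ji|ij] := ltngtP i j.
    + by have [_ _ _ /(_ i ij)[]] := eP j jn.
    + by have [_ _ _ /(_ j ji)[]] := eP i i_n.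
    + by subst j; have [] := eP i i_n.
  have xiC i x : (i < n)%N -> `|(e i).2 x| <= 4 * `|x|.
    by move=> i_n; have [] := eP i i_n.
  have [N [zeta [zeta1 zetaV]]] := @finitely_many_norming_functionals
    R X n (fun i => (e i).1) (fun i => (e i).2) 4 xiu xiC.
  have [u [u1 uP]] := @unit_vector_common_kernel R X (n + N)
    (fun k => if (k < n)%N then (e k).2 else zeta (k - n)%N) infX.
  have xiu0 i : (i < n)%N -> (e i).2 u = 0.
    by move=> i_n; have := uP i (ltn_addr _ i_n); rewrite i_n.
  have zetau0 i : (i < N)%N -> zeta i u = 0.
    move=> iN; have := uP (n + i)%N; rewrite ltn_add2l => /(_ iN).
    by rewrite ltnNge leq_addr/= addKn.
  pose V := [set v : X | exists c : 'I_n -> R, v = \sum_(j < n) c j *: (e j).1].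
  have [||||f [fV fu fn]] := @annihilating_functional R X V u 4^-1.
  - by exists (fun=> 0); rewrite big1// => j _; rewrite scale0r.
  - move=> t _ _ [c ->] [c' ->]; exists (fun j => t * c j + c' j).
    rewrite scaler_sumr -big_split/=; apply: eq_bigr => j _.
    by rewrite scalerDl scalerA.
  - by lra.
  (* As [zeta i u = 0], the norm of [v] is at most [2 * |u - v|]. Hence [1 <= 3 * |u - v|], which
     leaves room for [4^-1]. *)
  - move=> _ [c ->]; have [i [iN]] := zetaV c.
    set v := \sum_(j < n) _ => vi.
    have zv : zeta i v <= `|u - v|.
      apply: le_trans (zeta1 i _); rewrite linearB zetau0// sub0r normrN.
      exact: ler_norm.
    have := ler_normD (u - v) v; rewrite subrK u1; lra.
  exists (u, f); split=> //= [x|i i_n]; first by rewrite -[4]invrK.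
  split; first exact: xiu0.
  apply: fV; exists (fun j => (j == Ordinal i_n)%:R).
  rewrite (bigD1 (Ordinal i_n))//= eqxx scale1r big1 ?addr0// => j /negbTE->.
  by rewrite scale0r.
exists (fun n => (e n).1), (fun n => (e n).2); split=> [n|n x|m n].
- by have [] := eP n.
- by have [] := eP n.
have [mn|nm|mn] := ltngtP m n.
- by have [_ _ _ /(_ m mn)[]] := eP n.
- by have [_ _ _ /(_ n nm)[]] := eP m.
- by subst n; have [] := eP m.
Qed.

(** * Bumps between the two largest members of a family *)

(* With [e = 0] this is [sup_j a_j]; with [e_j = [j = i]] it is
   [max (sup_(j != i) a_j) (a_i - 1)]. *)
Definition sup_offset (R : realType) (a e : nat -> R) : R :=
  sup (range (fun j => a j - e j)).

Definition bump (R : realType) (a : nat -> R) (i : nat) : R :=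
  sup_offset a (fun=> 0) - sup_offset a (fun j => (j == i)%:R).

(* At most one bump is nonzero; if they all vanish the value is irrelevant. *)
Definition active (R : realType) (a : nat -> R) : nat :=
  xget 0%N [set i | 0 < bump a i].

Section bumps.
Context (R : realType).
Implicit Types (a b e c : nat -> R) (i j : nat).

Let bounded_above a := exists C, forall j, a j <= C.

Lemma sup_offset_ge a e j : bounded_above a -> (forall j, 0 <= e j) ->
  a j - e j <= sup_offset a e.
Proof.
move=> [C aC] e0; apply: ub_le_sup; last by exists j.
by exists C => _ [k _ <-]; rewrite (le_trans _ (aC k))// gerBl.
Qed.

Lemma sup_offset_le a e r : (forall j, a j - e j <= r) -> sup_offset a e <= r.
Proof.
move=> er; apply: ge_sup; first by exists (a 0%N - e 0%N); exists 0%N.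
by move=> _ [j _ <-].
Qed.

Lemma sup_offset_adherent a eps : bounded_above a -> 0 < eps ->
  exists j, sup_offset a (fun=> 0) - eps < a j.
Proof.
move=> [C aC] eps0; have [|_ [j _ <-] jP] := @sup_adherent R
  (range (fun j => a j - 0)) eps eps0.
- split; first by exists (a 0%N - 0); exists 0%N.
  by exists C => _ [k _ <-]; rewrite subr0.
- by exists j; rewrite -[ltRHS]subr0.
Qed.

Lemma sup_offset_dist a b e eps : bounded_above a -> bounded_above b ->
  (forall j, 0 <= e j) -> (forall j, `|a j - b j| <= eps) ->
  `|sup_offset a e - sup_offset b e| <= eps.
Proof.
move=> ba bb e0 ab; rewrite ler_distl; apply/andP; split.
  rewrite lerBlDr; apply: sup_offset_le => j.
  have := sup_offset_ge j ba e0; have := ab j; rewrite ler_norml => /andP[]; lra.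
apply: sup_offset_le => j.
have := sup_offset_ge j bb e0; have := ab j; rewrite ler_norml => /andP[]; lra.
Qed.

Lemma sup_offset_conv a b e z t : bounded_above a -> bounded_above b ->
  (forall j, 0 <= e j) -> 0 <= t -> t <= 1 ->
  (forall j, z j <= t * a j + (1 - t) * b j) ->
  sup_offset z e <= t * sup_offset a e + (1 - t) * sup_offset b e.
Proof.
move=> ba bb e0 t0 t1 zab; apply: sup_offset_le => j.
have := sup_offset_ge j ba e0; have := sup_offset_ge j bb e0.
move: (zab j) t0 t1; nra.
Qed.

Let M a := sup_offset a (fun=> 0).
Let S a i := sup_offset a (fun j => (j == i)%:R).

Let leM a i : bounded_above a -> a i <= M a.
Proof. by move=> ba; rewrite -[a i]subr0; exact: (@sup_offset_ge a (fun=> 0)). Qed.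

Let leS a i j : bounded_above a -> j != i -> a j <= S a i.
Proof.
move=> ba /negbTE ji.
have := @sup_offset_ge a (fun j => (j == i)%:R) j ba (fun=> ler0n _ _).
by rewrite ji subr0.
Qed.

Let SM a i : bounded_above a -> S a i <= M a.
Proof.
move=> ba; apply: sup_offset_le => j.
by rewrite (le_trans _ (leM j ba))// gerBl ler0n.
Qed.

Lemma bump_ge0 a i : bounded_above a -> 0 <= bump a i.
Proof. by move=> ba; rewrite subr_ge0; exact: SM. Qed.

Lemma bump_le1 a i : bounded_above a -> bump a i <= 1.
Proof.
move=> ba; rewrite lerBlDr; apply: sup_offset_le => j; rewrite subr0.
have := @sup_offset_ge a (fun j => (j == i)%:R) j ba (fun=> ler0n _ _).
by case: (j == i); rewrite ?mulr1n ?mulr0n; lra.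
Qed.

(** All other members are at most [S a i], so if this lies below the supremum only [a i] can reach
    it. *)
Lemma bump_gt0_max a i : bounded_above a -> 0 < bump a i -> a i = M a.
Proof.
move=> ba; rewrite subr_gt0 -/(M a) -/(S a i) => SltM.
have : M a <= Num.max (S a i) (a i).
  apply: sup_offset_le => j; rewrite subr0 le_max.
  by have [->|/(leS ba)->//] := eqVneq j i; rewrite lexx orbT.
rewrite le_max leNgt SltM/= => Mai.
by apply/eqP; rewrite eq_le Mai leM.
Qed.

Lemma bump_gt0_unique a i j : bounded_above a -> 0 < bump a i -> j != i ->
  bump a j = 0.
Proof.
move=> ba bi ji; apply/eqP; rewrite subr_eq0 -/(M a) -/(S a j) eq_le SM// andbT.
by rewrite -(bump_gt0_max ba bi); apply: leS => //; rewrite eq_sym.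
Qed.

Lemma activeP a i : bounded_above a -> 0 < bump a i -> active a = i.
Proof.
move=> ba bi; apply: xget_unique => //= j bj; apply/eqP/negP => /negP ji.
by move: bj; rewrite (bump_gt0_unique ba bi ji) ltxx.
Qed.

Lemma bump_inactive a i : bounded_above a -> i != active a -> bump a i = 0.
Proof.
move=> ba ia; apply/eqP; rewrite eq_le bump_ge0// andbT leNgt; apply/negP => bi.
by move: ia; rewrite (activeP ba bi) eqxx.
Qed.

Lemma bump_dist a b i eps : bounded_above a -> bounded_above b ->
  (forall j, `|a j - b j| <= eps) -> `|bump a i - bump b i| <= 2 * eps.
Proof.
move=> ba bb ab.
have := @sup_offset_dist a b (fun=> 0) eps ba bb (fun=> lexx _) ab.
have := @sup_offset_dist a b (fun j => (j == i)%:R) eps ba bb (fun=> ler0n _ _) ab.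
rewrite !ler_norml /bump => /andP[? ?] /andP[? ?]; apply/andP; split; lra.
Qed.

(** If the active indices differ, each bump vanishes for the other sequence and is therefore at most
    [2 * eps]. *)
Lemma active_bump_dist (V : normedModType R) (v : nat -> V) a b eps D :
  bounded_above a -> bounded_above b -> (forall i, `|v i| <= D) ->
  (forall j, `|a j - b j| <= eps) ->
  `|bump a (active a) *: v (active a) - bump b (active b) *: v (active b)|
    <= 4 * eps * D.
Proof.
move=> ba bb vD ab.
have D0 : 0 <= D by exact: le_trans (vD 0%N).
have eps0 : 0 <= eps by exact: le_trans (ab 0%N).
have [E|E] := eqVneq (active a) (active b).
  rewrite -E -scalerBl normrZ ler_pM// (le_trans (bump_dist _ ba bb ab))//.
  by lra.
have Ea : bump a (active a) <= 2 * eps.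
  have := bump_dist (active a) ba bb ab.
  by rewrite (bump_inactive bb E) subr0 ger0_norm// bump_ge0.
have Eb : bump b (active b) <= 2 * eps.
  have := bump_dist (active b) ba bb ab; rewrite eq_sym in E.
  by rewrite (bump_inactive ba E) sub0r normrN ger0_norm// bump_ge0.
have H (r : R) i : 0 <= r -> r <= 2 * eps -> `|r *: v i| <= 2 * eps * D.
  by move=> r0 r2; rewrite normrZ ler_pM// ger0_norm.
rewrite (le_trans (ler_normB _ _))//.
have := H _ (active a) (bump_ge0 _ ba) Ea.
have := H _ (active b) (bump_ge0 _ bb) Eb.
by lra.
Qed.

(** Lowered by [1], the member [a i] still dominates the others, so the bump has full height. This
    is the situation at the points where values are prescribed. *)
Lemma gap1_active a i : bounded_above a ->
  (forall j, j != i -> 1 + a j <= a i) -> active a = i /\ bump a i = 1.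
Proof.
move=> ba gap; suff b1 : bump a i = 1.
  by split=> //; apply: activeP => //; rewrite b1.
apply/eqP; rewrite eq_le bump_le1//= lerBrDr -lerBrDl.
apply: sup_offset_le => j; have := leM i ba.
have [->|ji] := eqVneq j i; rewrite -/(M a) ?mulr1n ?mulr0n; first by lra.
by have := gap j ji; lra.
Qed.

(* Convexity comes from the representation of this expression as
   [sup_i (2 - c_i) a_i + c_i S_i], where each term is a nonnegative combination
   of the convex quantities [a_i] and [S_i]. *)
Let gap_form c a := 2 * M a - c (active a) * bump a (active a).

Let gap_form_ge c a i : bounded_above a -> (forall i, 0 <= c i <= 1) ->
  (2 - c i) * a i + c i * S a i <= gap_form c a.
Proof.
move=> ba c01; rewrite /gap_form.
have [ci0 ci1] := andP (c01 i).
have := leM i ba; have := SM i ba.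
have [<-|iact] := eqVneq i (active a).
  have bE : bump a i = M a - S a i by [].
  rewrite bE; nra.
have [|b0] := leP (bump a (active a)) 0.
  rewrite le_eqVlt ltNge bump_ge0// orbF => /eqP ->; nra.
(* The left side is at most [2 * M a - (2 - c i) * (M a - S a j)], and [2 - c i >= 1 >= c j]. This
   is what the factor [2] in [gap_form] is for. *)
set j := active a in iact b0 *.
have aj : a j = M a by exact: bump_gt0_max.
have aS : a i <= S a j by exact: leS.
have bE : bump a j = M a - S a j by [].
have [cj0 cj1] := andP (c01 j).
by rewrite bE in b0 *; nra.
Qed.

(** A positive bump gives equality at the active index. Otherwise every [S a i] equals [M a], and a
    nearly maximal [a i] loses at most [(2 - c i) * eps]. *)
Let gap_form_adherent c a eps : bounded_above a -> (forall i, 0 <= c i <= 1) ->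
  0 < eps -> exists i, gap_form c a - 2 * eps <= (2 - c i) * a i + c i * S a i.
Proof.
move=> ba c01 eps0; rewrite /gap_form.
have [|b0] := leP (bump a (active a)) 0; last first.
  exists (active a); rewrite (bump_gt0_max ba b0).
  have -> : bump a (active a) = M a - S a (active a) by [].
  by lra.
rewrite le_eqVlt ltNge bump_ge0// orbF => /eqP b0.
have [i aiM] := sup_offset_adherent ba eps0; exists i.
have : bump a i = 0.
  by have [->//|] := eqVneq i (active a); exact: bump_inactive.
have -> : bump a i = M a - S a i by [].
move=> /eqP; rewrite subr_eq0 => /eqP <-.
have [ci0 ci1] := andP (c01 i).
by rewrite b0; move: aiM; rewrite -/(M a); nra.
Qed.

Lemma gap_form_conv c a b z t : bounded_above a -> bounded_above b ->
  bounded_above z ->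
  (forall i, 0 <= c i <= 1) -> 0 <= t -> t <= 1 ->
  (forall j, z j <= t * a j + (1 - t) * b j) ->
  2 * M z - c (active z) * bump z (active z) <=
    t * (2 * M a - c (active a) * bump a (active a)) +
    (1 - t) * (2 * M b - c (active b) * bump b (active b)).
Proof.
move=> ba bb bz c01 t0 t1 zab; rewrite -/(gap_form c z).
rewrite -/(gap_form c a) -/(gap_form c b).
apply/ler_addgt0Pr => eps eps0.
have [i iP] := gap_form_adherent bz c01 (divr_gt0 eps0 (ltr0Sn R 1)).
have Ha := gap_form_ge i ba c01; have Hb := gap_form_ge i bb c01.
have Sz := @sup_offset_conv a b (fun j => (j == i)%:R) z t ba bb
  (fun=> ler0n _ _) t0 t1 zab.
have [ci0 ci1] := andP (c01 i).
have zi := zab i.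
have t10 : 0 <= 1 - t by lra.
have H1 := ler_wpM2l t0 Ha; have H2 := ler_wpM2l t10 Hb.
have c20 : 0 <= 2 - c i by lra.
have H3 := ler_wpM2l c20 zi; have H4 := ler_wpM2l ci0 Sz.
have H : (2 - c i) * z i + c i * S z i <=
  t * ((2 - c i) * a i + c i * S a i) +
  (1 - t) * ((2 - c i) * b i + c i * S b i).
  by apply: le_trans (lerD H3 H4) _; rewrite /S le_eqVlt; apply/orP; left; apply/eqP; ring.
by lra.
Qed.

End bumps.

(** * Delta-convexity of the mapping built from bumps *)

Definition selection (R : realType) (X Y : normedModType R)
    (h : nat -> X -> R) (y0 : Y) (y : nat -> Y) (x : X) : Y :=
  let a := h ^~ x in y0 + bump a (active a) *: (y (active a) - y0).

(** One control function serves all [phi]: adding it to [phi] of the mapping gives a constant plus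
    [2 * D] times the convex expression of [gap_form_conv], with weights [c i] depending on
    [phi]. *)
Lemma delta_convex_selection (R : realType) (X Y : normedModType R) (A : set X)
    (h : nat -> X -> R) (y0 : Y) (y : nat -> Y) (D : R) :
  open A -> convex_set A -> (forall i, convex_function A (h i)) ->
  (forall x, A x -> exists C, forall i, h i x <= C) ->
  (forall x, A x -> forall e, 0 < e -> exists r, 0 < r /\
     forall x', `|x - x'| < r -> forall i, `|h i x - h i x'| <= e) ->
  (forall i, `|y i - y0| <= D) ->
  delta_convex A (selection h y0 y).
Proof.
move=> oA cA ch bh eh yD.
wlog D0 : D yD / 0 < D.
  move=> H; apply: (H (Num.max D 1)) => [i|].
    by rewrite le_max yD.
  by rewrite lt_max ltr01 orbT.
(* Stated for general [v]: the vectors [y i - y0] give continuity of the mapping, the constant [1]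
   that of the bump inside the control function. *)
have H (V : normedModType R) (v : nat -> V) (E : R) x e : A x -> 0 < e ->
    (forall i, `|v i| <= E) -> exists r, 0 < r /\ forall x', `|x - x'| < r ->
    A x' /\ `|bump (h^~ x) (active (h^~ x)) *: v (active (h^~ x)) -
     bump (h^~ x') (active (h^~ x')) *: v (active (h^~ x'))| <= e /\
     `|sup_offset (h^~ x) (fun=> 0) - sup_offset (h^~ x') (fun=> 0)| <= e.
  move=> Ax e0 vE.
  have E0 : 0 <= E by exact: le_trans (vE 0%N).
  have e'0 : 0 < e / (4 * E + 1) by rewrite divr_gt0//; lra.
  have [r1 [r10 rP1]] := eh x Ax _ e'0.
  have [r2 [r20 rP2]] := open_ballP oA Ax.
  exists (Num.min r1 r2); split; first by rewrite lt_min r10.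
  move=> x'; rewrite lt_min => /andP[/rP1 x1 /rP2 Ax'].
  have e'E : e / (4 * E + 1) * (4 * E + 1) = e by rewrite divfK//; lra.
  split => //; split.
    apply: le_trans (active_bump_dist (bh x Ax) (bh x' Ax') vE x1) _.
    by nra.
  have := sup_offset_dist (bh x Ax) (bh x' Ax') (fun=> lexx 0) x1.
  by move=> /le_trans; apply; nra.
split.
  apply/open_within_continuousP => // x Ax e e0.
  have [r [r0 rP]] := H _ (fun i => y i - y0) D x e Ax e0 yD.
  exists r; split => // x' /rP[Ax' [b1 _]]; split => //.
  by rewrite /selection opprD addrACA subrr add0r.
exists (fun x => D * (4 * sup_offset (h^~ x) (fun=> 0) -
  bump (h^~ x) (active (h^~ x)))); split.
  apply/open_within_continuousP => // x Ax e e0.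
  have e'0 : 0 < e / (5 * D) by rewrite divr_gt0//; lra.
  have [|r [r0 rP]] := H R^o (fun=> 1) 1 x _ Ax e'0.
    by move=> _; rewrite normr1.
  exists r; split => // x' /rP[Ax' [b1 b2]]; split => //; move: b1 b2.
  rewrite /GRing.scale/= !mulr1 -mulrBr normrM (gtr0_norm D0).
  move=> b1 b2; rewrite -ler_pdivlMl//.
  have -> : D^-1 * e = 5 * (e / (5 * D)) by field; lra.
  move: b1 b2; rewrite !ler_norml => /andP[? ?] /andP[? ?].
  by apply/andP; split; lra.
move=> phi cphi n1; apply/convex_functionP => x x' t Ax Ax' t0 t1.
pose c i := (D - phi (y i - y0)) / (2 * D).
have c01 i : 0 <= c i <= 1.
  have := le_trans (dual_normP (y i - y0) cphi n1) (yD i).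
  rewrite ler_norml => /andP[? ?]; apply/andP; split.
    by apply: divr_ge0; lra.
  by rewrite ler_pdivrMr; lra.
have E z : phi (selection h y0 y z) + D * (4 * sup_offset (h^~ z) (fun=> 0) -
    bump (h^~ z) (active (h^~ z))) = phi y0 + 2 * D *
    (2 * sup_offset (h^~ z) (fun=> 0) -
     c (active (h^~ z)) * bump (h^~ z) (active (h^~ z))).
  rewrite /selection linearD linearZ/= /c /GRing.scale/=; field.
  by rewrite gt_eqF.
rewrite !E.
have cz := convex_setP cA Ax Ax' t0 t1.
have zab j : h j (t *: x + (1 - t) *: x') <= t * h j x + (1 - t) * h j x'.
  exact: (convex_functionP A (h j)).1 (ch j) x x' t Ax Ax' t0 t1.
have := gap_form_conv (bh x Ax) (bh x' Ax') (bh _ cz) c01 t0 t1 zab.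
have D20 : 0 <= 2 * D by lra.
move=> /(ler_wpM2l D20) /(lerD (lexx (phi y0))) /le_trans; apply.
by rewrite le_eqVlt; apply/orP; left; apply/eqP; ring.
Qed.

(** * Convex functions that are unbounded on a segment *)

Lemma locally_lipschitz_continuous (R : realType) (X : normedModType R)
    (A : set X) (mu : X -> R) :
  open A ->
  (forall x, A x -> exists r L, [/\ 0 < r, 0 < L & forall y, `|x - y| < r ->
     `|mu x - mu y| <= L * `|x - y|]) ->
  {within A, continuous (mu : X -> R^o)}.
Proof.
move=> oA lA; apply/open_within_continuousP => // x Ax e e0.
have [r [r0 rA]] := open_ballP oA Ax.
have [r' [L [r'0 L0 rL]]] := lA x Ax.
exists (Num.min r (Num.min r' (e / L))); split.
  by rewrite !lt_min r0 r'0 divr_gt0.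
move=> y; rewrite !lt_min => /and3P[/rA Ay /rL xy].
rewrite ltr_pdivlMr// => xye; split=> //.
by rewrite (le_trans xy)// mulrC ltW.
Qed.

Section distance_to_complement.
Context (R : realType) (X : normedModType R) (A : set X) (b : X).
Context (nAb : ~ A b) (oA : open A) (cA : convex_set A).

(** The point [b] makes the complement nonempty, so this [inf] is the actual distance. *)
Let d (x : X) : R := inf [set `|x - y| | y in ~` A].

Let dle x y : ~ A y -> d x <= `|x - y|.
Proof.
by move=> nAy; apply: ge_inf; [exists 0 => _ [z _ <-]|exists y].
Qed.

Let led x r : (forall y, ~ A y -> r <= `|x - y|) -> r <= d x.
Proof.
move=> rA; apply: lb_le_inf; first by exists `|x - b|; exists b.
by move=> _ [y nAy <-]; exact: rA.
Qed.

Let d_gt0 x : A x -> 0 < d x.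
Proof.
move=> Ax; have [r [r0 rA]] := open_ballP oA Ax.
apply: lt_le_trans r0 _; apply: led => y nAy; rewrite leNgt.
by apply/negP => /rA.
Qed.

Let d_ball x y : `|x - y| < d x -> A y.
Proof. by move=> xy; apply: contrapT => /(dle x); rewrite leNgt xy. Qed.

Let d_lip x y : d x <= d y + `|x - y|.
Proof.
rewrite -lerBlDr; apply: led => w nAw; rewrite lerBlDr.
have := dle x nAw; have := ler_normD (x - y) (y - w).
by rewrite addrA subrK; lra.
Qed.

(** A point [w] outside [A] closer than [rho] to [z] is impossible: moving [x] and [y] by [w - z]
    scaled with [d x / rho] and [d y / rho] stays in [A], and the moved points combine to [w]. *)
Let d_concave x y t : A x -> A y -> 0 <= t -> t <= 1 ->
  t * d x + (1 - t) * d y <= d (t *: x + (1 - t) *: y).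
Proof.
move=> Ax Ay t0 t1; have dx := d_gt0 Ax; have dy := d_gt0 Ay.
set z := t *: x + _; set rho := t * d x + _.
have rho0 : 0 < rho by rewrite /rho; nra.
apply: led => w nAw; rewrite leNgt; apply/negP => zw; apply: nAw.
have key p : 0 < d p -> A (p + (d p / rho) *: (w - z)).
  move=> dp; apply: (@d_ball p); rewrite opprD addrA subrr sub0r normrN normrZ.
  rewrite gtr0_norm ?divr_gt0// distrC mulrAC ltr_pdivrMr//.
  by rewrite ltr_pM2l.
have := convex_setP cA (key x dx) (key y dy) t0 t1.
have [v vE] : exists v, v = w - z by exists (w - z).
rewrite -vE !scalerDr addrACA -/z !scalerA -scalerDl.
have -> : t * (d x / rho) + (1 - t) * (d y / rho) = 1.
  by rewrite /rho; field; rewrite gt_eqF.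
by rewrite scale1r vE addrC subrK.
Qed.

Lemma invf_distance_convex : convex_function A (fun x => (d x)^-1 : R^o).
Proof.
apply/convex_functionP => x y t Ax Ay t0 t1.
have dx := d_gt0 Ax; have dy := d_gt0 Ay.
have rho0 : 0 < t * d x + (1 - t) * d y by nra.
have dz := d_concave Ax Ay t0 t1.
apply: (@le_trans _ _ (t * d x + (1 - t) * d y)^-1).
  by rewrite lef_pV2// posrE (lt_le_trans rho0).
rewrite -div1r ler_pdivrMr// -subr_ge0.
(* The defect in the weighted harmonic-arithmetic mean inequality is a square. *)
have -> : (t * (d x)^-1 + (1 - t) * (d y)^-1) * (t * d x + (1 - t) * d y) - 1 =
   t * (1 - t) * (d x - d y) ^+ 2 / (d x * d y).
  by field; rewrite !gt_eqF.
have t10 : 0 <= 1 - t by lra.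
apply: divr_ge0; last exact: mulr_ge0 (ltW dx) (ltW dy).
by apply: mulr_ge0; [exact: mulr_ge0|exact: sqr_ge0].
Qed.

Lemma invf_distance_continuous :
  {within A, continuous (fun x => (d x)^-1 : R^o)}.
Proof.
apply: locally_lipschitz_continuous => // x Ax; have dx := d_gt0 Ax.
exists (d x / 2), (2 / (d x * d x)); split; rewrite ?divr_gt0 ?mulr_gt0//.
move=> y xy; have Ay : A y by apply: (@d_ball x); lra.
have dy := d_gt0 Ay; have xy1 := d_lip x y; have yx1 := d_lip y x.
have d2 : d x / 2 <= d y by lra.
have -> : (d x)^-1 - (d y)^-1 = (d y - d x) / (d x * d y).
  by field; rewrite !gt_eqF.
rewrite normrM [X in _ * X]gtr0_norm ?invr_gt0 ?mulr_gt0//.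
rewrite ler_pdivrMr ?mulr_gt0//.
have -> : 2 / (d x * d x) * `|x - y| * (d x * d y) = 2 * d y / d x * `|x - y|.
  by field; rewrite !gt_eqF.
have : `|d y - d x| <= `|x - y|.
  have yx := distrC y x; rewrite ler_norml; apply/andP; split; lra.
move=> /le_trans; apply; rewrite -[leLHS]mul1r ler_wpM2r//.
by rewrite ler_pdivlMr//; lra.
Qed.

(** On the way from [a] to [b] the parameters inside [A] form an interval [[0, s)]. Near the exit
    point the distance to the complement is arbitrarily small. *)
Lemma invf_distance_unbounded a m : A a -> exists z th,
  [/\ A (a + z), 0 < th, th < 1 & m <= (d (a + th *: z))^-1].
Proof.
move=> Aa; pose v := b - a.
have v0 : 0 < `|v|.
  rewrite normr_gt0 subr_eq0; apply/eqP => ba; exact: nAb (eq_ind_r A Aa ba).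
pose T := [set t | 0 <= t /\ A (a + t *: v)].
have Tdown t s : T t -> 0 <= s -> s <= t -> T s.
  move=> [t0 At] s0 st; split => //.
  have [t00|tn0] := eqVneq t 0.
    by rewrite (_ : s = 0) ?scale0r ?addr0//; lra.
  have tp : 0 < t by rewrite lt_neqAle eq_sym tn0.
  have := @convex_setP _ _ _ cA _ _ (s / t) At Aa.
  rewrite scalerDr scalerA divfK// addrAC -scalerDl [s / t + _]addrC subrK scale1r.
  by apply; rewrite ?divr_ge0// ler_pdivrMr// mul1r.
have T1 t : T t -> t <= 1.
  move=> Tt; rewrite leNgt; apply/negP => t1; apply: nAb.
  by have [_] := Tdown t 1 Tt ler01 (ltW t1); rewrite scale1r /v addrC subrK.
have sT : has_sup T.
  split; last by exists 1.
  by exists 0; split => //; rewrite scale0r addr0.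
pose s := sup T.
have Tlt t : 0 <= t -> t < s -> T t.
  move=> t0 ts; have st : 0 < s - t by rewrite subr_gt0.
  have [w Tw tw] := sup_adherent st sT.
  by apply: Tdown Tw t0 _; rewrite subKr in tw; exact: ltW.
have Topen t : T t -> exists2 t', t < t' & T t'.
  move=> [t0 At]; have [r [r0 rA]] := open_ballP oA At.
  have e0 : 0 < r / (2 * `|v|) by rewrite divr_gt0// mulr_gt0.
  exists (t + r / (2 * `|v|)); first by rewrite ltrDl.
  split; first by rewrite addr_ge0// ltW.
  apply: rA; rewrite scalerDl addrA opprD addrA subrr sub0r normrN normrZ.
  rewrite gtr0_norm// (_ : r / (2 * `|v|) * `|v| = r / 2); last first.
    by field; rewrite gt_eqF.
  by lra.
have sub t : T t -> t < s.
  move=> /Topen[t' tt' Tt']; apply: lt_le_trans tt' _.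
  by apply: ub_le_sup => //; exact: sT.2.
have nAs : ~ A (a + s *: v).
  move=> As; have : T s; last by move=> /sub; rewrite ltxx.
  by split=> //; apply: ltW; apply: sub; split => //; rewrite scale0r addr0.
have s0 : 0 < s by apply: sub; split => //; rewrite scale0r addr0.
pose m' := Num.max m 1.
have m'0 : 0 < m' by rewrite lt_max ltr01 orbT.
pose de := Num.min (s / 2) (m' * `|v|)^-1.
have de0 : 0 < de by rewrite lt_min divr_gt0// invr_gt0 mulr_gt0.
have des : de <= s / 2 by rewrite ge_min lexx.
have dem : de <= (m' * `|v|)^-1 by rewrite ge_min lexx orbT.
have t'0 : 0 < s - de / 2 by lra.
(* The endpoint has parameter [s - de / 2], the intermediate point [s - de]; both lie before the
   exit parameter [s]. *)
exists ((s - de / 2) *: v), ((s - de) / (s - de / 2)).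
have [_ At'] : T (s - de / 2) by apply: Tlt; lra.
split=> //; first by rewrite divr_gt0//; lra.
  by rewrite ltr_pdivrMr//; lra.
rewrite scalerA divfK ?gt_eqF//.
have At : A (a + (s - de) *: v) by have [] : T (s - de) by apply: Tlt; lra.
have dt := d_gt0 At.
apply: (@le_trans _ _ m'); first by rewrite le_max lexx.
rewrite -[m']invrK lef_pV2 ?posrE ?invr_gt0//.
apply: le_trans (dle _ nAs) _.
rewrite opprD addrACA subrr add0r -scalerBl addrAC subrr sub0r normrZ normrN.
rewrite gtr0_norm//; move: dem; rewrite invfM.
by rewrite -ler_pdivlMr.
Qed.

End distance_to_complement.

(** The reciprocal distance to the complement works if [A] is not the whole space, and the norm if
    it is. *)
Lemma exists_unbounded_convex_on_segments (R : realType) (X : normedModType R)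
    (A : set X) (a : X) :
  ~ finite_dimensional X -> open A -> convex_set A -> A a ->
  exists mu : X -> R^o, [/\ convex_function A mu, {within A, continuous mu} &
    forall m, exists z th,
      [/\ A (a + z), 0 < th, th < 1 & m <= mu (a + th *: z)]].
Proof.
move=> infX oA cA Aa; have [[b nAb]|AT] := pselect (exists b, ~ A b).
  exists (fun x => (inf [set `|x - y| | y in ~` A])^-1); split.
  - exact: invf_distance_convex nAb oA cA.
  - exact: invf_distance_continuous nAb oA.
  - by move=> m; exact: invf_distance_unbounded nAb oA cA _ _ Aa.
have {}AT x : A x by apply: contrapT => nAx; apply: AT; exists x.
pose z0 : {linear X -> R^o} := \0.
have [e [e1 _]] := unit_vector_common_kernel 0 (fun=> z0) infX.
exists (fun x => `|x|); split.
- apply/convex_functionP => x y t _ _ t0 t1.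
  rewrite (le_trans (ler_normD _ _))// !normrZ ger0_norm// ger0_norm//.
  by rewrite subr_ge0.
- apply: continuous_subspaceT; exact: norm_continuous.
- move=> m; exists ((2 * (`|m| + `|a|)) *: e), (2^-1); split; [exact: AT|lra|lra|].
  rewrite scalerA mulrA mulVf// mul1r.
  have := ler_normB (a + (`|m| + `|a|) *: e) a.
  rewrite addrAC subrr add0r normrZ e1 mulr1 ger0_norm ?addr_ge0//.
  have := ler_norm m; lra.
Qed.

(** * Boundedness of delta-convex mappings *)

(* Near [p] the control function is bounded because [p] is a convex combination
   of [q] and [a] and the control function is bounded near [a]; reflecting
   through a point close to [p] turns this into a bound on [H]. *)
Lemma delta_convex_bounded_between (R : realType) (X Z : normedModType R)
    (A : set X) (a : X) (H : X -> Z) :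
  open A -> A a -> delta_convex A H ->
  exists r, 0 < r /\ forall q th s, let p := th *: q + (1 - th) *: a in
    A q -> 0 < th -> th < 1 -> 0 < s -> s < (1 - th) * r ->
    (forall u, `|u| <= 1 -> A (p + s *: u)) ->
    exists C, forall u, `|u| <= 1 -> `|H (p + s *: u)| <= C.
Proof.
move=> oA Aa [cH [f [cf fP]]].
have [r [r0 rP]] := (open_within_continuousP f oA).1 cf a Aa 1 ltr01.
exists r; split => // q th s p Aq th0 th1 s0 sr Aball.
have Ap : A p by have := Aball 0; rewrite normr0 scaler0 addr0; exact.
have convf : convex_function A f.
  pose z : {linear Z -> R^o} := \0.
  have [cz nz] : continuous z /\ dual_norm z <= 1.
    by apply: dual_norm_le1 => y; rewrite normr0.
  have := fP z cz nz; rewrite (_ : (fun x => _) = f)//.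
  by apply/funext => x; rewrite /= add0r.
pose C1 := th * f q + (1 - th) * (f a + 1).
have t1 : 0 < 1 - th by lra.
have fC1 u : `|u| <= 1 -> f (p + s *: u) <= C1.
  move=> u1; have vr : `|a - (a + (s / (1 - th)) *: u)| < r.
    rewrite opprD addrA subrr sub0r normrN normrZ gtr0_norm ?divr_gt0//.
    apply: (@le_lt_trans _ _ (s / (1 - th))).
      by rewrite -[leRHS]mulr1 ler_wpM2l// divr_ge0// ltW.
    by rewrite ltr_pdivrMr// mulrC.
  have [Av] := rP _ vr; rewrite ler_norml => /andP[fv _].
  have -> : p + s *: u = th *: q + (1 - th) *: (a + (s / (1 - th)) *: u).
    by rewrite scalerDr scalerA mulrC divfK ?gt_eqF// addrA.
  apply: le_trans ((convex_functionP _ _).1 convf _ _ _ Aq Av (ltW th0) (ltW th1)) _.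
  by rewrite lerD2l ler_wpM2l ?(ltW t1)//; lra.
have [rho [rho0 rhoP]] := (open_within_continuousP H oA).1 cH p Ap 1 ltr01.
(* Small enough for the reflected point [p - s * e * u] to lie where continuity bounds [H]. *)
pose e := Num.min 1 (rho / (2 * s)).
have s20 : 0 < 2 * s by lra.
have e0 : 0 < e by rewrite lt_min ltr01 divr_gt0.
have e1 : e <= 1 by rewrite ge_min lexx.
have erho : e * s <= rho / 2.
  have : e <= rho / (2 * s) by rewrite ge_min lexx orbT.
  by rewrite ler_pdivlMr//; lra.
pose C2 := `|H p| + 1.
(* The weight for which [p] is the combination of [p + s *: u] and its reflection. *)
pose la := e / (1 + e).
have la0 : 0 < la by rewrite divr_gt0//; lra.
have la1 : la <= 1 by rewrite ler_pdivrMr; lra.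
exists ((C1 + 2 * C2 - f p) / la) => u u1.
have [phi0 [phi0H phi0n]] := norming_functional (H (p + s *: u)).
(* With the minus sign, convexity at [p] bounds the norm at [p + s *: u] from above. *)
pose phi : {linear Z -> R^o} := \- phi0.
have phin y : `|phi y| <= `|y| by rewrite /= normrN.
have [cphi nphi] := dual_norm_le1 phin.
have nu1 : `|- e *: u| <= 1.
  by rewrite scaleNr normrN normrZ gtr0_norm// mulr_ile1// ltW.
have xm : `|p - (p + s *: (- e *: u))| < rho.
  rewrite opprD addrA subrr sub0r normrN scalerA mulrN scaleNr normrN normrZ.
  rewrite gtr0_norm ?mulr_gt0//.
  have : s * e * `|u| <= s * e by rewrite ler_piMr// mulr_ge0// ltW.
  by lra.
have [Axm Hxm] := rhoP _ xm.
have Hxm2 : `|H (p + s *: (- e *: u))| <= C2.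
  have := ler_normB (H p) (H p - H (p + s *: (- e *: u))).
  by rewrite subKr /C2; lra.
have := (convex_functionP _ _).1 (fP phi cphi nphi) _ _ la (Aball u u1) Axm
  (ltW la0) la1.
have -> : la *: (p + s *: u) + (1 - la) *: (p + s *: (- e *: u)) = p.
  rewrite (scalerDr la p) (scalerDr (1 - la) p) addrACA -scalerDl [la + _]addrC subrK scale1r !scalerA.
  rewrite -scalerDl (_ : la * s + _ = 0) ?scale0r ?addr0//.
  by rewrite /la; field; lra.
rewrite ler_pdivlMr//.
have -> : phi (H (p + s *: u)) = - `|H (p + s *: u)| by rewrite /= phi0H.
have := phin (H p); have := phin (H (p + s *: (- e *: u))).
rewrite !ler_norml => /andP[_ b1] /andP[b2 _].
have f1 := fC1 u u1; have f2 := fC1 _ nu1.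
have H0 : `|H p| <= C2 by rewrite /C2; lra.
set n := `|H (p + s *: u)|; set b3 := phi (H p) in b2 *.
set b4 := phi (H _) in b1 *; set f3 := f (p + s *: u) in f1 *.
set f4 := f (p + _) in f2 *.
have C20 : 0 <= C2 by rewrite /C2; have := normr_ge0 (H p); lra.
have t1a : 0 <= 1 - la by lra.
have h1 : la * f3 <= la * C1 by rewrite ler_pM2l.
have h2 : (1 - la) * f4 <= (1 - la) * C1 by rewrite ler_wpM2l.
have h3 : (1 - la) * b4 <= (1 - la) * C2 by rewrite ler_wpM2l//; lra.
have h4 : (1 - la) * C2 <= C2 by rewrite ler_piMl//; lra.
by lra.
Qed.

(** * The blocks *)

Lemma exists_bound_lt (R : realType) (f : nat -> R) n :
  exists C, 0 <= C /\ forall j, (j < n)%N -> f j <= C.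
Proof.
exists (\sum_(i < n) `|f i|); split=> [|j jn]; first exact: sumr_ge0.
rewrite (bigD1 (Ordinal jn))//= (le_trans (ler_norm _))// lerDl.
exact: sumr_ge0.
Qed.

(** Assigns infinitely many indices to each block, by the exponent of [2] in [i.+1]. *)
Lemma exists_infinitely_repeating :
  exists ka : nat -> nat, forall k N, exists2 i, (N <= i)%N & ka i = k.
Proof.
exists (fun i => logn 2 i.+1) => k N.
have pos : (0 < 2 ^ k * N.*2.+1)%N by rewrite muln_gt0 expn_gt0.
exists (2 ^ k * N.*2.+1).-1; rewrite ?prednK//.
  rewrite -ltnS prednK// (@leq_trans N.*2.+1)//.
    by rewrite ltnS -addnn leq_addr.
  by rewrite leq_pmull// expn_gt0.
rewrite lognM ?expn_gt0// pfactorK// logn_coprime ?addn0//.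
by rewrite coprime2n /= odd_double.
Qed.

(* The block [k] lives in the ball of radius [s k] around
   [p k = th k * q k + (1 - th k) * a]; the slope [be k] is so large that the
   term [be k * (mu x - mu (p k) + 1)] dominates all the terms
   [(s j)^-1 * xi (x - p j)] that matter, with norms of [xi] at most [4]. *)
Lemma exists_blocks (R : realType) (X : normedModType R) (A : set X) (a : X)
    (mu : X -> R^o) :
  open A -> convex_set A -> A a -> {within A, continuous mu} ->
  (forall m, exists z th,
      [/\ A (a + z), 0 < th, th < 1 & m <= mu (a + th *: z)]) ->
  exists (q p : nat -> X) (th s be : nat -> R), forall k,
  [/\ [/\ A (q k), 0 < th k, th k < 1 & p k = th k *: q k + (1 - th k) *: a],
      [/\ 0 < s k, s k <= 1 & s k * k.+1%:R <= 1 - th k],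
      forall u, `|u| <= 1 -> A (p k + s k *: u) /\
        `|mu (p k) - mu (p k + s k *: u)| <= 1 / 2,
      [/\ k%:R <= mu (p k), 0 <= be k &
          4 / s k * (k%:R + `|p k|) <= be k] &
      forall j, (j < k)%N -> [/\ mu (p j) + 2 <= mu (p k),
        8 / s k * (`|p j| + 1 + `|p k|) <= be k &
        2 * (4 / s j * (`|p k| + 1 + `|p j|) +
             be j * (mu (p k) - mu (p j) + 3 / 2)) <= be k]].
Proof.
move=> oA cA Aa cmu muP.
pose T := (X * R * R * R)%type.
pose q (x : T) := x.1.1.1; pose th (x : T) := x.1.1.2.
pose s (x : T) := x.1.2; pose be (x : T) := x.2.
pose p x := th x *: q x + (1 - th x) *: a.
pose P k (e : nat -> T) (x : T) :=
  [/\ [/\ A (q x), 0 < th x & th x < 1],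
      [/\ 0 < s x, s x <= 1 & s x * k.+1%:R <= 1 - th x],
      forall u, `|u| <= 1 -> A (p x + s x *: u) /\
        `|mu (p x) - mu (p x + s x *: u)| <= 1 / 2,
      [/\ k%:R <= mu (p x), 0 <= be x &
          4 / s x * (k%:R + `|p x|) <= be x] &
      forall j, (j < k)%N -> [/\ mu (p (e j)) + 2 <= mu (p x),
        8 / s x * (`|p (e j)| + 1 + `|p x|) <= be x &
        2 * (4 / s (e j) * (`|p x| + 1 + `|p (e j)|) +
             be (e j) * (mu (p x) - mu (p (e j)) + 3 / 2)) <= be x]].
have [||e eP] := @dependent_sequence T (0, 0, 0, 0) P.
- move=> k e e' x ee' [H1 H2 H3 H4 H5]; split=> // j jk.
  by rewrite -ee'//; exact: H5.
- move=> k e _.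
  have [C [C0 CP]] := exists_bound_lt (fun j => mu (p (e j)) + 2) k.
  have [z [t [Aq t0 t1 mC]]] := muP (C + k%:R).
  have pE : t *: (a + z) + (1 - t) *: a = a + t *: z.
    by rewrite scalerDr addrAC -scalerDl [t + _]addrC subrK scale1r.
  have Ap : A (a + t *: z).
    by rewrite -pE; apply: (convex_setP cA) => //; exact: ltW.
  have half : 0 < 1 / 2 :> R by lra.
  have [r [r0 rP]] := (open_within_continuousP mu oA).1 cmu _ Ap _ half.
  pose sg := Num.min (r / 2) (Num.min 1 ((1 - t) / k.+1%:R)).
  have sg0 : 0 < sg.
    by rewrite !lt_min ltr01 !divr_gt0//= subr_gt0.
  have sgr : sg <= r / 2 by rewrite ge_min lexx.
  have sg1 : sg <= 1 by rewrite !ge_min lexx !orbT.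
  have sgt : sg <= (1 - t) / k.+1%:R by rewrite !ge_min lexx !orbT.
  have [C1 [C10 C1P]] := exists_bound_lt
    (fun j => 8 / sg * (`|p (e j)| + 1 + `|a + t *: z|)) k.
  have [C2 [C20 C2P]] := exists_bound_lt
    (fun j => 2 * (4 / s (e j) * (`|a + t *: z| + 1 + `|p (e j)|) +
             be (e j) * (mu (a + t *: z) - mu (p (e j)) + 3 / 2))) k.
  have C30 : 0 <= 4 / sg * (k%:R + `|a + t *: z|).
    by rewrite mulr_ge0// ?addr_ge0// divr_ge0// ltW.
  (* The slope is a sum of nonnegative terms, one for each lower bound imposed on it. *)
  exists (a + z, t, sg, 4 / sg * (k%:R + `|a + t *: z|) + C1 + C2).
  rewrite /P /p /q /th /s /be /= !pE; split=> //.
  + by split=> //; rewrite -ler_pdivlMr.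
  + move=> u u1; apply: rP; rewrite opprD addrA subrr sub0r normrN normrZ.
    rewrite gtr0_norm//; have : sg * `|u| <= sg by rewrite ler_piMr// ltW.
    by lra.
  + split; [|by rewrite !addr_ge0|by rewrite -addrA lerDl addr_ge0].
    by rewrite (le_trans _ mC)// lerDr.
  + move=> j jk; have := CP j jk; have := C1P j jk; have := C2P j jk.
    have := ler0n R k => k0 d1 d2 d3; split.
    * by rewrite (le_trans d3)// (le_trans _ mC)// lerDl.
    * by rewrite (le_trans d2)// addrAC lerDr addr_ge0.
    * by rewrite (le_trans d1)// lerDr addr_ge0.
exists (q \o e), (p \o e), (th \o e), (s \o e), (be \o e) => k.
by have [[A1 A2 A3] H2 H3 H4 H5] := eP k; split.
Qed.

(** * The family of convex functions behind the bumps *)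

Lemma convex_function_affine (R : realType) (X : normedModType R) (A : set X)
    (mu : X -> R^o) (phi : {linear X -> R^o}) (p : X) (b m : R) :
  0 <= b -> convex_function A mu ->
  convex_function A (fun x => phi (x - p) + b * (mu x - m) : R^o).
Proof.
move=> b0 /convex_functionP cmu; apply/convex_functionP => x y t Ax Ay t0 t1.
have cxy := ler_wpM2l b0 (cmu x y t Ax Ay t0 t1).
rewrite !linearB linearD !linearZ/= /GRing.scale/=.
move: cxy; set f := mu (_ + _); lra.
Qed.

Lemma convex_function_max0 (R : realType) (X : normedModType R) (A : set X)
    (f : X -> R^o) :
  convex_function A f -> convex_function A (fun x => Num.max 0 (f x) : R^o).
Proof.
move=> /convex_functionP cf; apply/convex_functionP => x y t Ax Ay t0 t1.
have t10 : 0 <= 1 - t by lra.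
have m0 (r : R) : 0 <= Num.max 0 r by rewrite le_max lexx.
have mr (r : R) : r <= Num.max 0 r by rewrite le_max lexx orbT.
rewrite ge_max; apply/andP; split; first by rewrite addr_ge0// mulr_ge0.
by rewrite (le_trans (cf x y t Ax Ay t0 t1))// lerD// ler_wpM2l.
Qed.

(** The last clause places infinitely many [w i] in one ball, with a radius small enough for
    [delta_convex_bounded_between]. *)
Lemma exists_bump_family (R : realType) (X : normedModType R) (A : set X)
    (a : X) :
  ~ finite_dimensional X -> open A -> convex_set A -> A a ->
  exists (h : nat -> X -> R) (w : nat -> X),
  [/\ forall i, convex_function A (h i : X -> R^o),
      forall x, A x -> exists C, forall i, h i x <= C,
      forall x, A x -> forall e, 0 < e -> exists r, 0 < r /\
        forall x', `|x - x'| < r -> forall i, `|h i x - h i x'| <= e,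
      forall i, A (w i) /\ forall j, j != i -> 1 + h j (w i) <= h i (w i) &
      forall r, 0 < r -> exists q th s, let p := th *: q + (1 - th) *: a in
        [/\ [/\ A q, 0 < th & th < 1], 0 < s, s < (1 - th) * r,
          forall u, `|u| <= 1 -> A (p + s *: u) &
          forall N, exists i u, [/\ (N <= i)%N, `|u| <= 1 & w i = p + s *: u]]].
Proof.
move=> infX oA cA Aa.
have [mu [cvmu cmu muP]] := exists_unbounded_convex_on_segments infX oA cA Aa.
have [q [p [th [s [be bP]]]]] := exists_blocks oA cA Aa cmu muP.
have [ka kaP] := exists_infinitely_repeating.
have [u [xi [u1 xi4 xiu]]] := bounded_biorthogonal_sequence infX.
have s0 k : 0 < s k by have [_ [+ _ _] _ _ _] := bP k.
have be0 k : 0 <= be k by have [_ _ _ [_ + _] _] := bP k.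
have s40 k : 0 <= 4 / s k by rewrite divr_ge0// ltW.
pose g i x : R := (s (ka i))^-1 * xi i (x - p (ka i)) +
  be (ka i) * (mu x - (mu (p (ka i)) - 1)).
pose h i x : R := Num.max 0 (g i x).
pose w i := p (ka i) + s (ka i) *: u i.
have xib i x : (s (ka i))^-1 * xi i x <= 4 / s (ka i) * `|x|.
  rewrite mulrAC [leRHS]mulrC ler_wpM2l ?invr_ge0 ?(ltW (s0 _))//.
  exact: le_trans (ler_norm _) (xi4 i x).
have xid i x : `|(s (ka i))^-1 * xi i x| <= 4 / s (ka i) * `|x|.
  by rewrite normrM gtr0_norm ?invr_gt0// mulrAC [leRHS]mulrC ler_wpM2l// invr_ge0 ltW.
(* In a late block [mu (p k) >= k] makes the factor of [be k] at most [-1], and [be k] outweighs the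
   [xi] term; only the blocks before [K] are visible near [x]. *)
have local0 x : A x -> exists r K, 0 < r /\ forall y, `|x - y| < r ->
    [/\ A y, `|mu x - mu y| <= 1 & forall i, (K <= ka i)%N -> h i y = 0].
  move=> Ax; have [r [r0 rP]] := (open_within_continuousP mu oA).1 cmu x Ax 1 ltr01.
  pose K := (Num.truncn (`|mu x| + `|x| + 3)).+1.
  have KP : `|mu x| + `|x| + 3 < K%:R by exact: truncnS_gt.
  exists (Num.min r 1), K; split; first by rewrite lt_min r0 ltr01.
  move=> y; rewrite lt_min => /andP[/rP[Ay muy] xy]; split=> // i Ki.
  have [_ _ _ [kmu _ kbe] _] := bP (ka i).
  have Kk : K%:R <= (ka i)%:R :> R by rewrite ler_nat.
  have gi0 : g i y <= 0.
    have := xib i (y - p (ka i)).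
    have ny : `|y - p (ka i)| <= (ka i)%:R + `|p (ka i)|.
      have := ler_normB y (p (ka i)); have := ler_normB x (x - y).
      by rewrite subKr; have := normr_ge0 (mu x); lra.
    have := ler_wpM2l (s40 (ka i)) ny.
    have : mu y - (mu (p (ka i)) - 1) <= -1.
      move: muy; rewrite ler_norml => /andP[? ?].
      by have := ler_norm (mu x); have := normr_ge0 x; lra.
    by move=> /(ler_wpM2l (be0 (ka i))); rewrite /g; lra.
  by apply/eqP; rewrite eq_le le_max lexx ge_max lexx gi0.
have maxd (x y : R) : `|Num.max 0 x - Num.max 0 y| <= `|x - y|.
  have := ler_norm (x - y); have := ler_norm (y - x); rewrite [`|y - x|]distrC.
  have := normr_ge0 (x - y) => ? ? ?; rewrite ler_norml.
  by have [?|?] := leP 0 x; have [?|?] := leP 0 y; apply/andP; split; lra.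
exists h, w; split.
- move=> i; apply: convex_function_max0.
  exact: (@convex_function_affine R X A mu ((s (ka i))^-1 \*: xi i)).
- move=> x Ax; have [r [K [r0 rP]]] := local0 x Ax.
  have [|_ _ hK] := rP x; first by rewrite subrr normr0.
  (* A block has infinitely many indices, but the common bound [4] on the [xi] leaves one estimate
     per block. *)
  have [C [C0 CP]] := exists_bound_lt (fun k => 4 / s k * `|x - p k| +
    be k * (mu x - (mu (p k) - 1))) K.
  exists C => i; have [/hK ->//|ik] := leqP K (ka i).
  rewrite ge_max C0 (le_trans _ (CP _ ik))// /g lerD2r.
  exact: xib.
- move=> x Ax e e0; have [r [K [r0 rP]]] := local0 x Ax.
  have [|_ _ hK] := rP x; first by rewrite subrr normr0.
  have [C [C0 CP]] := exists_bound_lt (fun k => 4 / s k + be k) K.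
  have C1 : 0 < C + 1 by lra.
  have eC : 0 < e / (C + 1) by rewrite divr_gt0.
  have [r' [r'0 rP']] := (open_within_continuousP mu oA).1 cmu x Ax _ eC.
  exists (Num.min r (Num.min r' (e / (C + 1)))); split.
    by rewrite !lt_min r0 r'0.
  move=> y; rewrite !lt_min => /and3P[/rP[Ay _ hKy] /rP'[_ muxy] xy] i.
  have [Ki|ik] := leqP K (ka i).
    by rewrite hK// hKy// subrr normr0 ltW.
  apply: le_trans (maxd _ _) _.
  have -> : g i x - g i y = (s (ka i))^-1 * xi i (x - y) +
      be (ka i) * (mu x - mu y).
    by rewrite /g !linearB; ring.
  apply: le_trans (ler_normD _ _) _.
  rewrite [X in _ + X]normrM (ger0_norm (be0 _)).
  have h1 := xid i (x - y); have h2 := ler_wpM2l (s40 (ka i)) (ltW xy).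
  have h3 := ler_wpM2l (be0 (ka i)) muxy.
  have h4 := ler_wpM2r (ltW eC) (CP _ ik).
  have : C * (e / (C + 1)) <= e.
    by rewrite mulrA ler_pdivrMr// mulrC ler_wpM2l ?(ltW e0)//; lra.
  by lra.
- move=> i; have [_ [_ s1 _] ball [kmu _ _] prev] := bP (ka i).
  have ui1 : `|u i| <= 1 by rewrite u1.
  have [Aw muw] := ball _ ui1; split => // j ji.
  move: muw; rewrite -/(w i) ler_norml => /andP[muw1 muw2].
  have wpi : w i - p (ka i) = s (ka i) *: u i by rewrite /w addrAC subrr add0r.
  have ssi : (s (ka i))^-1 * s (ka i) = 1 by rewrite mulVf// gt_eqF.
  have giE : g i (w i) = 1 + be (ka i) * (mu (w i) - (mu (p (ka i)) - 1)).
    by rewrite /g wpi linearZ/= xiu eqxx /GRing.scale/= mulr1 ssi.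
  have gi1 : 1 + be (ka i) / 2 <= g i (w i).
    rewrite giE lerD2l ler_wpM2l//; lra.
  apply: (@le_trans _ _ (g i (w i))); last by rewrite le_max lexx orbT.
  suff gj : 1 + g j (w i) <= g i (w i).
    have [g0|g0] := leP 0 (g j (w i)); rewrite /h.
      by rewrite max_r.
    by rewrite max_l ?(ltW g0)// addr0; have := be0 (ka i); lra.
  have nw : `|w i| <= `|p (ka i)| + 1.
    rewrite /w (le_trans (ler_normD _ _))// lerD2l normrZ u1 mulr1.
    by rewrite gtr0_norm.
  have nwp : `|w i - p (ka j)| <= `|p (ka i)| + 1 + `|p (ka j)|.
    by have := ler_normB (w i) (p (ka j)); lra.
  have xj := le_trans (xib j _) (ler_wpM2l (s40 (ka j)) nwp).
  (* If [j] is in a later block, its steep slope makes [g j (w i)] at most [0]. If in an earlier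
     one, [be (ka i) / 2] dominates it. In the same block the slope terms agree and biorthogonality
     gives the gap [1]. *)
  have [ij|kji|kij] := ltngtP (ka i) (ka j).
  + have [_ _ _ _ /(_ _ ij)[mup bej _]] := bP (ka j).
    have : mu (w i) - (mu (p (ka j)) - 1) <= - (1 / 2) by lra.
    move=> /(ler_wpM2l (be0 (ka j))) b1.
    have := be0 (ka i); rewrite {1}/g.
    have := mulr_ge0 (s40 (ka j)) (normr_ge0 (w i)).
    lra.
  + have [mup _ bei] := prev _ kji.
    have : mu (w i) - (mu (p (ka j)) - 1) <= mu (p (ka i)) - mu (p (ka j)) + 3 / 2.
      by lra.
    by move=> /(ler_wpM2l (be0 (ka j))); rewrite {1}/g; lra.
  + rewrite giE /g -kij wpi linearZ/= xiu (negbTE ji).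
    by rewrite /GRing.scale/= mulr0 mulr0 add0r.
(* Then [r * k.+1%:R > 1], so [s k * k.+1%:R <= 1 - th k] makes the radius less than
   [(1 - th k) * r]. *)
- move=> r r0; pose k := Num.truncn r^-1.
  have kr : r^-1 < k.+1%:R by exact: truncnS_gt.
  have [[Aq t0 t1 pE] [_ _ sk] ball _ _] := bP k.
  exists (q k), (th k), (s k); rewrite /= -pE; split=> //.
  + have k0 : 0 < k.+1%:R :> R by rewrite ltr0n.
    have rk : 1 < r * k.+1%:R by rewrite -ltr_pdivrMl// mulr1.
    have st := s0 k; nra.
  + by move=> v /ball[].
  + move=> N; have [i Ni <-] := kaP k N.
    by exists i, (u i); rewrite u1.
Qed.

(** * Prescribing values on which [G] is unbounded *)

Theorem theorem5p5 (R : realType) (X Y Z : normedModType R)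
    (hX : ~ finite_dimensional X)
    (A : set X) (A0 : A !=set0) (openA : open A) (convA : convex_set A)
    (B : set Y) (convB : convex_set B)
    (G : Y -> Z)
    (hG : exists S : set Y,
        [/\ S `<=` B, bounded_set S & ~ [bounded G y | y in S]]) :
  exists F : X -> Y,
    [/\ forall x, A x -> B (F x), delta_convex A F & ~ delta_convex A (G \o F)].
Proof.
have [a Aa] := A0; have [S [SB bS nbG]] := hG.
have [D DP] : exists D, forall y, S y -> `|y| <= D.
  by have /pinfty_ex_gt0[D _ DP] := bS; exists D.
have /choice[y yP] : forall i, exists y, S y /\ i%:R < `|G y|.
  move=> i; apply: contrapT => ny; apply: nbG.
  exists i%:R; split=> [|M iM z Sz /=]; first exact: realn.
  rewrite (le_trans _ (ltW iM))// leNgt; apply/negP => iz.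
  by apply: ny; exists z.
have [h [w [ch bh eh hw blocks]]] := exists_bump_family hX openA convA Aa.
have Fw i : selection h (y 0%N) y (w i) = y i.
  have [Aw gap] := hw i; rewrite /selection.
  have [-> ->] := gap1_active (bh _ Aw) gap.
  by rewrite scale1r addrC subrK.
exists (selection h (y 0%N) y); split.
- move=> x Ax; have b0 := bump_ge0 (active (h^~ x)) (bh x Ax).
  have b1 := bump_le1 (active (h^~ x)) (bh x Ax).
  have := convex_setP convB (SB _ (yP (active (h^~ x))).1) (SB _ (yP 0%N).1) b0 b1.
  by rewrite [(1 - _) *: _]scalerBl scale1r addrCA -scalerBr.
- apply: (@delta_convex_selection _ _ _ _ _ _ _ (D + D)) => // i.
  by rewrite (le_trans (ler_normB _ _))// lerD// DP//; exact: (yP _).1.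
- move=> dcH.
  have [r [r0 rP]] := delta_convex_bounded_between openA Aa dcH.
  have [q [th [s [[Aq t0 t1] s0 sr ball inf_i]]]] := blocks r r0.
  have [C CP] := rP q th s Aq t0 t1 s0 sr ball.
  (* An index beyond [|C|] in the same ball violates the bound [C], since [G (y i)] has norm greater
     than [i]. *)
  have [i [u [Ni u1 wi]]] := inf_i (Num.truncn `|C|).+1.
  have := CP u u1; rewrite -wi /= Fw leNgt => /negP; apply.
  apply: le_lt_trans (ler_norm C) _; apply: lt_trans (truncnS_gt _) _.
  by apply: le_lt_trans (yP i).2; rewrite ler_nat.
Qed.
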